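(* Consider the two-segment ($m=2$) total-energy platooning problem with arbitrary $n$ and identical vehicle parameters, $C_j=C$, $\delta_j=\delta$, $S_{j1}=S$, $\beta_j=\beta$ for all $j$: choose two permutations $(1_1,\ldots,n_1)$ and $(1_2,\ldots,n_2)$ of $(1,\ldots,n)$ to minimize $\sum_{j=1}^n\delta\,[D_1(1-\eta_{j_1})+D_2(1-\eta_{j_2})]$ subject to $S-\frac{\delta}{C}[D_1(1-\eta_{j_1})+D_2(1-\eta_{j_2})]\ge\beta$ for all $j$. Rule 3 solves this problem in $O(n)$ time, either by finding an optimal solution or verifying that the problem is infeasible.
   Context: Setting. There are $n$ vehicles and two road segments of lengths $D_1,D_2>0$. All vehicles have battery capacity $C>0$, usage rate $\delta>0$, initial state of charge $S\in[0,1]$, and minimum allowable final state of charge $\beta$ with $0\le\beta<S$. Platoon positions have usage-rate reductions $0\le\eta_1\le\cdots\le\eta_n<1$. In a solution, $j_i$ denotes the position of vehicle $j$ in segment $i$ (for each $i$, $j\mapsto j_i$ is a permutation of $\{1,\ldots,n\}$). Vehicle $j$ uses energy $\delta\sum_{i=1}^2D_i(1-\eta_{j_i})$, and its final state of charge is $S$ minus this quantity divided by $C$. A solution is feasible if each vehicle's final state of charge is at least $\beta$; the problem is infeasible if no feasible solution exists. Rule 3: Assign vehicle $j$ to position $j$ in segment 1 and to position $n-j+1$ in segment 2, for $j=1,\ldots,n$. (If this assignment is not feasible, infeasibility is reported.) Running time counts elementary arithmetic operations and comparisons. *)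

(* Defs.v *)
From mathcomp Require Import all_boot all_order all_fingroup all_algebra.
Set Implicit Arguments.
Unset Strict Implicit.
Unset Printing Implicit Defensive.
Import Order.TTheory GRing.Theory Num.Theory.
Local Open Scope ring_scope.

(* Vehicles and platoon positions 1..n are both represented by 'I_n, the
   ordinal i standing for the number i.+1. *)

Record instance (R : realFieldType) (n : nat) := Instance {
  len1 : R;             (* D_1 *)
  len2 : R;             (* D_2 *)
  capacity : R;         (* C *)
  rate : R;             (* delta *)
  charge : R;           (* S *)
  min_charge : R;       (* beta *)
  reduction : 'I_n -> R (* eta *)
}.

(* (s.1 j, s.2 j) is the pair of positions (j_1, j_2) of vehicle j. *)
Definition solution (n : nat) : Type := ('S_n * 'S_n)%type.

Section Problem.
Variables (R : realFieldType) (n : nat) (P : instance R n).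

Definition energy (s : solution n) (j : 'I_n) : R :=
  rate P * (len1 P * (1 - reduction P (s.1 j))
            + len2 P * (1 - reduction P (s.2 j))).

Definition final_charge (s : solution n) (j : 'I_n) : R :=
  charge P - energy s j / capacity P.

Definition feasible (s : solution n) : Prop :=
  forall j : 'I_n, min_charge P <= final_charge s j.

Definition total_energy (s : solution n) : R := \sum_(j < n) energy s j.

Definition optimal (s : solution n) : Prop :=
  feasible s /\
  forall s' : solution n, feasible s' -> total_energy s <= total_energy s'.

Definition infeasible : Prop := ~ exists s : solution n, feasible s.

End Problem.

(* rev_ord i has value n - i.+1, i.e. position n - j + 1 for vehicle j = i.+1. *)
Definition rule3 (n : nat) : solution n :=
  (1%g, perm (@rev_ord_inj n)).

(* A small imperative language, used to count the operations executed by an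
   algorithm.  Its syntax mentions neither the field, nor n, nor the input, so
   a program is uniform in all of them.  Registers and arrays are named by
   natural numbers; array cells are indexed by natural numbers. *)

Inductive nexp : Type :=
| NConst of nat
| NVar of nat
| NGet of nat & nexp
| NAdd of nexp & nexp
| NSub of nexp & nexp.

Inductive rexp : Type :=
| ROne
| RVar of nat
| RGet of nat & nexp
| RAdd of rexp & rexp
| RSub of rexp & rexp
| RMul of rexp & rexp
| RDiv of rexp & rexp.

Inductive cmd : Type :=
| Skip
| NSet of nat & nexp                (* register := value *)
| NPut of nat & nexp & nexp         (* array[index] := value *)
| Seq of cmd & cmd
| IfLe of rexp & rexp & cmd & cmd   (* if e1 <= e2 then c1 else c2 *)
| For of nat & nexp & cmd.          (* for x := 1 to e do c *)

Record state (R : Type) := State {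
  nvar : nat -> nat;
  narr : nat -> nat -> nat;
  rvar : nat -> R;
  rarr : nat -> nat -> R
}.

Definition set_nvar (R : Type) (s : state R) (x v : nat) : state R :=
  State (fun y => if y == x then v else nvar s y) (narr s) (rvar s) (rarr s).

Definition set_narr (R : Type) (s : state R) (a i v : nat) : state R :=
  State (nvar s)
    (fun b k => if (b == a) && (k == i) then v else narr s b k)
    (rvar s) (rarr s).

Section Semantics.
Variable R : realFieldType.

Fixpoint neval (s : state R) (e : nexp) : nat :=
  match e with
  | NConst k => k
  | NVar x => nvar s x
  | NGet a e1 => narr s a (neval s e1)
  | NAdd e1 e2 => (neval s e1 + neval s e2)%N
  | NSub e1 e2 => (neval s e1 - neval s e2)%N
  end.

Fixpoint reval (s : state R) (e : rexp) : R :=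
  match e with
  | ROne => 1
  | RVar x => rvar s x
  | RGet a i => rarr s a (neval s i)
  | RAdd e1 e2 => reval s e1 + reval s e2
  | RSub e1 e2 => reval s e1 - reval s e2
  | RMul e1 e2 => reval s e1 * reval s e2
  | RDiv e1 e2 => reval s e1 / reval s e2
  end.

End Semantics.

(* Every arithmetic operation, on numbers or on indices, costs one unit. *)
Fixpoint ncost (e : nexp) : nat :=
  match e with
  | NConst _ | NVar _ => 0
  | NGet _ e1 => ncost e1
  | NAdd e1 e2 | NSub e1 e2 => (ncost e1 + ncost e2).+1
  end.

Fixpoint rcost (e : rexp) : nat :=
  match e with
  | ROne | RVar _ => 0
  | RGet _ i => ncost i
  | RAdd e1 e2 | RSub e1 e2 | RMul e1 e2 | RDiv e1 e2 =>
      (rcost e1 + rcost e2).+1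
  end.

(* [run c s] is the final state together with the number of arithmetic
   operations and comparisons executed.  Each loop iteration is charged 2 (the
   test and the increment of the counter) and leaving the loop 1 (the last
   test).  Data movements are not counted; since every iteration is charged,
   counting them as well would change the running time of a given program by at
   most a constant factor and an additive constant. *)
Fixpoint run (R : realFieldType) (c : cmd) (s : state R) : state R * nat :=
  match c with
  | Skip => (s, 0%N)
  | NSet x e => (set_nvar s x (neval s e), ncost e)
  | NPut a i e =>
      (set_narr s a (neval s i) (neval s e), (ncost i + ncost e)%N)
  | Seq c1 c2 =>
      let r1 := run c1 s in
      let r2 := run c2 r1.1 in
      (r2.1, (r1.2 + r2.2)%N)
  | IfLe e1 e2 c1 c2 =>
      let r := if reval s e1 <= reval s e2 then run c1 s else run c2 s in
      (r.1, ((rcost e1 + rcost e2).+1 + r.2)%N)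
  | For x e c1 =>
      foldl (fun (acc : state R * nat) (k : nat) =>
               let r := run c1 (set_nvar acc.1 x k) in
               (r.1, (acc.2 + 2 + r.2)%N))
            (s, (ncost e).+1) (iota 1 (neval s e))
  end.

(* Names of the natural-number registers, the natural-number (output) arrays,
   the real registers and the real (input) array. *)
Definition n_ : nat := 0.
Definition j_ : nat := 1.
Definition ok_ : nat := 2.
Definition pos1_ : nat := 0.
Definition pos2_ : nat := 1.
Definition D1_ : nat := 0.
Definition D2_ : nat := 1.
Definition C_ : nat := 2.
Definition delta_ : nat := 3.
Definition S_ : nat := 4.
Definition beta_ : nat := 5.
Definition eta_ : nat := 0.

(* ok := 1;
   for j := 1 to n do
     pos1[j] := j;
     pos2[j] := n - j + 1;
     if beta <= S - delta * (D1 * (1 - eta[pos1[j]])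
                             + D2 * (1 - eta[pos2[j]])) / C
     then skip else ok := 0 *)
Definition rule3_program : cmd :=
  Seq (NSet ok_ (NConst 1))
    (For j_ (NVar n_)
      (Seq (NPut pos1_ (NVar j_) (NVar j_))
      (Seq (NPut pos2_ (NVar j_) (NAdd (NSub (NVar n_) (NVar j_)) (NConst 1)))
        (IfLe (RVar beta_)
              (RSub (RVar S_)
                (RDiv
                  (RMul (RVar delta_)
                    (RAdd
                      (RMul (RVar D1_)
                        (RSub ROne (RGet eta_ (NGet pos1_ (NVar j_)))))
                      (RMul (RVar D2_)
                        (RSub ROne (RGet eta_ (NGet pos2_ (NVar j_)))))))
                  (RVar C_)))
          Skip
          (NSet ok_ (NConst 0)))))).

(* The input is stored in the machine, eta_k in cell k for 1 <= k <= n; all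
   other registers and cells contain 0. *)
Definition init (R : realFieldType) (n : nat) (P : instance R n) : state R :=
  State
    (fun x => if x == n_ then n else 0%N)
    (fun _ _ => 0%N)
    (fun x => nth 0 [:: len1 P; len2 P; capacity P; rate P; charge P;
                        min_charge P] x)
    (fun a k => if (a == eta_) && (0 < k)%N
                then oapp (reduction P) 0 (insub k.-1) else 0).

Definition returns (R : realFieldType) (n : nat) (s : state R)
    (sol : solution n) : Prop :=
  nvar s ok_ = 1%N /\
  forall j : 'I_n, narr s pos1_ j.+1 = (sol.1 j).+1 /\
                   narr s pos2_ j.+1 = (sol.2 j).+1.

Definition reports_infeasible (R : realFieldType) (s : state R) : Prop :=
  nvar s ok_ = 0%N.

(* Main.v *)
Require Import Defs.
From mathcomp Require Import all_boot all_order all_fingroup all_algebra.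
Set Implicit Arguments.
Unset Strict Implicit.
Unset Printing Implicit Defensive.
Import Order.TTheory GRing.Theory Num.Theory.
Local Open Scope ring_scope.

(** The total energy does not depend on the solution, so only feasibility is at
    stake. For any two permutations and any position j, at least j vehicles have
    position at most j in segment 1 and n - j + 1 have position at most n - j + 1
    in segment 2; as j + (n - j + 1) > n, some vehicle satisfies both, and it
    uses at least as much energy as vehicle j under Rule 3. Hence Rule 3 is
    feasible as soon as some solution is. *)

Lemma card_perm_leq (n : nat) (s : 'S_n) (i : 'I_n) :
  #|[set k | (s k <= i)%N]| = i.+1.
Proof.
have -> : [set k | (s k <= i)%N] = s @^-1: [set k : 'I_n | (k < i.+1)%N].
  by apply/setP => k; rewrite !inE ltnS.
rewrite card_preimset; last exact: perm_inj.
by rewrite cardsE -sum1_card (big_ord_narrow (ltn_ord i)) sum1_card card_ord.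
Qed.

Lemma perm_pigeonhole (n : nat) (s t : 'S_n) (i : 'I_n) :
  exists k, (s k <= i)%N && (t k <= rev_ord i)%N.
Proof.
set A := [set k | (s k <= i)%N]; set B := [set k | (t k <= rev_ord i)%N].
have: A :&: B != set0.
  (* If disjoint, the two sets would have a union of size (i + 1) + (n - i) = n + 1 inside
     ['I_n]. *)
  apply: contraTneq (max_card (A :|: B)) => AB0.
  rewrite -ltnNge card_ord cardsU AB0 cards0 subn0 !card_perm_leq /= addSn.
  by rewrite -subSn // subSS subnKC // ltnW.
by case/set0Pn => k; rewrite !inE => sik; exists k.
Qed.

Section Rule3.
Variables (R : realFieldType) (n : nat) (P : instance R n).

Lemma rule3_1 (j : 'I_n) : (rule3 n).1 j = j. Proof. exact: perm1. Qed.

Lemma rule3_2 (j : 'I_n) : (rule3 n).2 j = rev_ord j. Proof. exact: permE. Qed.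

(** Each permutation visits every position once, so reindexing removes it from the sum over its
    segment. *)
Lemma total_energy_const (s t : solution n) :
  total_energy P s = total_energy P t.
Proof.
suff total_energyE u : total_energy P u =
    rate P * (len1 P * (\sum_j (1 - reduction P j))
              + len2 P * (\sum_j (1 - reduction P j))).
  by rewrite !total_energyE.
rewrite /total_energy -mulr_sumr big_split -!mulr_sumr /=.
congr (_ * (_ * _ + _ * _)).
  exact/esym/(reindex_inj (@perm_inj _ u.1)).
exact/esym/(reindex_inj (@perm_inj _ u.2)).
Qed.

Lemma feasible_rule3 (s : solution n) :
  0 < len1 P -> 0 < len2 P -> 0 < capacity P -> 0 < rate P ->
  {homo reduction P : i k / (i <= k)%N >-> i <= k} ->
  feasible P s -> feasible P (rule3 n).
Proof.
move=> D1 D2 C0 d0 eta_homo feas j.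
have [k /andP[le1 le2]] := perm_pigeonhole s.1 s.2 j.
(* In both segments [k] has a position, hence a reduction, at most that of [j] under Rule 3. *)
apply: le_trans (feas k) _; rewrite lerD2l lerN2 ler_pM2r ?invr_gt0 //.
rewrite ler_pM2l // rule3_1 rule3_2 lerD // ler_pM2l // lerD2l lerN2.
  exact: eta_homo.
exact: eta_homo.
Qed.

(** Loop-invariant rule: [I k] describes the state and the accumulated cost after [k] iterations. It
    follows by induction on [k], splitting the last index off [iota]. *)
Lemma run_For (I : nat -> state R * nat -> Prop) x e c (s : state R) :
    I 0%N (s, (ncost e).+1) ->
    (forall k r, (k < neval s e)%N -> I k r ->
      let r' := run c (set_nvar r.1 x k.+1) in
      I k.+1 (r'.1, r.2 + 2 + r'.2)%N) ->
  I (neval s e) (run (For x e c) s).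
Proof.
move=> I0 IS /=; elim: {-2}(neval s e) (leqnn (neval s e)) => // k IHk lt_k.
by rewrite -addn1 iotaD foldl_cat /= add1n addn1; apply: IS (IHk (ltnW lt_k)).
Qed.

(* 13 = 2 + 2 + 9 operations per iteration: the loop control, the index
   n - j + 1, and the feasibility test. *)
Definition rule3_invariant (m : nat) (r : state R * nat) : Prop :=
  [/\ nvar r.1 n_ = n /\ rvar r.1 = rvar (init P),
      rarr r.1 = rarr (init P),
      forall j : 'I_n, (j < m)%N ->
        narr r.1 pos1_ j.+1 = j.+1 /\ narr r.1 pos2_ j.+1 = (rev_ord j).+1,
      nvar r.1 ok_ = [forall j : 'I_n, (j < m)%N ==>
                        (min_charge P <= final_charge P (rule3 n) j)]
    & r.2 = (13 * m).+1].

Lemma forall_ltS (m : 'I_n) (p : pred 'I_n) :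
  [forall j : 'I_n, (j < m.+1)%N ==> p j] =
  [forall j : 'I_n, (j < m)%N ==> p j] && p m.
Proof.
apply/forall_inP/andP => [all_p | [/forall_inP all_p pm] j].
  by split; [apply/forall_inP => j /ltnW|]; apply: all_p.
by rewrite ltnS leq_eqVlt => /orP[/eqP/val_inj-> | /all_p].
Qed.

Lemma rule3_program_invariant :
  rule3_invariant n (run rule3_program (init P)).
Proof.
rewrite /rule3_program; set body := Seq (NPut _ _ _) _.
set s0 := set_nvar (init P) ok_ 1.
change (rule3_invariant (neval s0 (NVar n_)) (run (For j_ (NVar n_) body) s0)).
apply: run_For => [|m [s t] lt_mn].
  by split=> //=; rewrite (_ : [forall j, _] = true) //; apply/forallP.
case=> [[/= sn sr] sa spos sok ->] /=.
pose j : 'I_n := Ordinal lt_mn.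
rewrite sn sr sa /= !eqxx addn1 /=.
(* Both reads of [eta_] are in range, so the default 0 in [init] is never returned. *)
rewrite (valK j) (valK (rev_ord j)) /=.
set test := min_charge P <= _.
have testE : test = (min_charge P <= final_charge P (rule3 n) j).
  by rewrite /final_charge /energy rule3_1 rule3_2.
split; rewrite /=.
- by case: test {testE}.
- by case: test {testE}.
(* This iteration writes only cell m + 1 of each array; earlier cells persist. *)
- move=> i; rewrite ltnS leq_eqVlt.
  have [-> _ | ne_im /= lt_im] := eqVneq (i : nat) m.
    by case: test {testE}; rewrite /= eqxx.
  by case: test {testE}; rewrite /= eqSS (negPf ne_im); apply: spos.
- rewrite (forall_ltS j) -testE.
  by case: test {testE}; rewrite ?andbT ?andbF.
- by case: test {testE}; rewrite mulnS [RHS]/= -addnA !addnS /= addnC.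
Qed.

End Rule3.

Theorem proposition4 :
  exists K : nat,
  forall (R : realFieldType) (n : nat) (P : instance R n),
    (0 < n)%N ->
    0 < len1 P -> 0 < len2 P ->
    0 < capacity P -> 0 < rate P ->
    0 <= charge P <= 1 ->
    0 <= min_charge P < charge P ->
    (forall i : 'I_n, 0 <= reduction P i < 1) ->
    (forall i k : 'I_n, (i <= k)%N -> reduction P i <= reduction P k) ->
    let out := run rule3_program (init P) in
    (out.2 <= K * n)%N /\
    ((returns out.1 (rule3 n) /\ optimal P (rule3 n)) \/
     (reports_infeasible out.1 /\ infeasible P)).
Proof.
(* The cost is 13 n + 1, at most 14 n because n is positive. *)
exists 14%N => R n P n_gt0 D1_gt0 D2_gt0 C_gt0 delta_gt0 _ _ _ eta_homo out.
have [_ _ pos_out ok_out cost_out] := rule3_program_invariant P.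
split; first by rewrite cost_out mulSn -add1n leq_add2r.
rewrite /returns /reports_infeasible ok_out.
case: forallP => [feas | infeas]; [left | right].
  split; first by split=> // j; rewrite rule3_1 rule3_2; apply: pos_out.
  split=> [j | s _]; first exact: implyP (feas j) (ltn_ord j).
  by rewrite (total_energy_const P _ s).
split=> // -[s /feasible_rule3 feas]; apply: infeas => j.
by apply/implyP => _; apply: feas.
Qed.
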